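(* Let $L$ be a completely distributive lattice which is upper well ordered, let $G$ be a group, and let $\mu\in L(G)$ be an $L$-group whose Frattini $L$-subgroup $\Phi(\mu)$ is finitely generated. Then the only $L$-subgroup $\eta$ of $\mu$ such that $\eta\circ\Phi(\mu)=\mu$ is $\eta=\mu$; that is, if $\eta\in L(\mu)$ and $\eta\circ\Phi(\mu)=\mu$, then $\eta=\mu$.
   Context: $L$ is a completely distributive lattice with least element $0$, and $G$ is a group. $L$ is upper well ordered if every non-empty subset of $L$ contains its supremum. An $L$-subset of $G$ is a function $G\to L$; $\eta\subseteq\mu$ means $\eta(x)\le\mu(x)$ for all $x\in G$. An $L$-subgroup of $G$ is an $L$-subset $\mu$ with $\mu(xy)\ge\mu(x)\wedge\mu(y)$ and $\mu(x^{-1})=\mu(x)$ for all $x,y\in G$; $L(G)$ is the set of these. For $\mu\in L(G)$, $L(\mu)$ is the set of $\eta\in L(G)$ with $\eta\subseteq\mu$ (the $L$-subgroups of $\mu$). The set product of $L$-subsets is $(\eta\circ\theta)(x)=\bigvee_{x=yz}\{\eta(y)\wedge\theta(z)\}$. For $a\in L$, $x\in G$, the $L$-point $a_x$ is the $L$-subset with value $a$ at $x$ and $0$ elsewhere; $a_x\in\mu$ means $\mu(x)\ge a$. An $L$-subgroup $\nu$ of $G$ is finitely generated if there are finitely many $L$-points ${a_1}_{x_1},\dots,{a_n}_{x_n}\in\nu$ such that $\nu$ is the smallest $L$-subgroup of $G$ containing their union (pointwise join). $\eta\in L(\mu)$ is proper if $\eta$ is non-constant and $\eta\ne\mu$. A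 proper $L$-subgroup $\eta$ of $\mu$ is a maximal $L$-subgroup of $\mu$ if, whenever $\eta\subseteq\theta\subseteq\mu$ with $\theta\in L(\mu)$, either $\theta=\eta$ or $\theta=\mu$. The Frattini $L$-subgroup $\Phi(\mu)$ is the intersection (pointwise meet) of all maximal $L$-subgroups of $\mu$, and $\Phi(\mu)=\mu$ if $\mu$ has no maximal $L$-subgroups. *)

(* Defs.v *)
From mathcomp Require Import all_boot all_order.
From mathcomp Require Import boolp classical_sets.

Set Implicit Arguments.
Unset Strict Implicit.
Unset Printing Implicit Defensive.

Import Order.TTheory.

Local Open Scope classical_set_scope.
Local Open Scope order_scope.

Section CompleteLattices.
Context {d : Order.disp_t} {L : tbLatticeType d}.

(* The default values make [lsup set0 = \bot] and [linf set0 = \top].  The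
   values on other sets are the intended ones as soon as the suprema and infima
   exist, i.e. under [complete_lattice] below. *)
Definition lsup (A : set L) : L := supremum \bot A.
Definition linf (A : set L) : L := infimum \top A.

End CompleteLattices.

Definition complete_lattice {d : Order.disp_t} (L : tbLatticeType d) : Prop :=
  forall A : set L, supremums A !=set0 /\ infimums A !=set0.

(* [f] ranges over the choice functions of the family [J]. *)
Definition completely_distributive {d : Order.disp_t} (L : tbLatticeType d)
    : Prop :=
  complete_lattice L /\
  forall (I : Type) (J : I -> set L),
    linf (range (fun i => lsup (J i))) =
    lsup [set linf (range f) | f in [set f : I -> L | forall i, J i (f i)]].

Definition upper_well_ordered {d : Order.disp_t} (L : tbLatticeType d) : Prop :=
  forall A : set L, A !=set0 -> A (lsup A).

Section LSubsets.
Context {d : Order.disp_t} {L : tbLatticeType d} {G : groupType}.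

Definition Lsubset (eta mu : G -> L) : Prop := forall x, eta x <= mu x.

Definition Lsubgroup (mu : G -> L) : Prop :=
  (forall x y, Order.meet (mu x) (mu y) <= mu (x * y)%g) /\
  (forall x, mu (x^-1)%g = mu x).

Definition Lsubgroup_of (mu eta : G -> L) : Prop :=
  Lsubgroup eta /\ Lsubset eta mu.

Definition Lprod (eta theta : G -> L) : G -> L := fun x =>
  lsup [set a | exists y z,
    x = (y * z)%g /\ a = Order.meet (eta y) (theta z)].

Definition Lpoint (a : L) (x : G) : G -> L :=
  fun y => if y == x then a else \bot.

Definition Lpoint_in (a : L) (x : G) (mu : G -> L) : Prop := a <= mu x.

(* Pointwise join of the L-points [a_x] for [(a, x)] in the list [s]. *)
Definition Lpoints_union (s : seq (L * G)) : G -> L :=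
  fun y => \join_(p <- s) Lpoint p.1 p.2 y.

Definition Lgenerated_by (nu xi : G -> L) : Prop :=
  [/\ Lsubgroup nu, Lsubset xi nu &
      forall theta, Lsubgroup theta -> Lsubset xi theta -> Lsubset nu theta].

Definition Lfinitely_generated (nu : G -> L) : Prop :=
  exists s : seq (L * G),
    (forall p, p \in s -> Lpoint_in p.1 p.2 nu) /\
    Lgenerated_by nu (Lpoints_union s).

Definition Lproper (mu eta : G -> L) : Prop :=
  [/\ Lsubgroup_of mu eta, ~ (exists c, forall x, eta x = c) & eta <> mu].

Definition Lmaximal (mu eta : G -> L) : Prop :=
  Lproper mu eta /\
  forall theta, Lsubgroup_of mu theta -> Lsubset eta theta ->
    theta = eta \/ theta = mu.

Definition Frattini (mu : G -> L) : G -> L := fun x =>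
  if `[< exists eta, Lmaximal mu eta >]
  then linf [set eta x | eta in [set eta | Lmaximal mu eta]]
  else mu x.

End LSubsets.

(* Main.v *)
Require Import Defs.
From mathcomp Require Import all_boot all_order.
From mathcomp Require Import boolp classical_sets.

(** Suppose that [eta] is an L-subgroup of [mu] with
    [eta o Phi(mu) = mu] and [eta <> mu].  Then [eta] does not contain
    [Phi(mu)], since an L-subgroup containing both factors of a set product
    contains the product ([Lprod_subset]).  Zorn's lemma provides an
    L-subgroup [M] that is maximal among the L-subgroups of [mu] which contain
    [eta] but not [Phi(mu)] ([maximal_avoiding]).  This [M] is a maximal
    L-subgroup of [mu]: any strictly larger [theta] contains [Phi(mu)] as well
    as [eta], hence contains [eta o Phi(mu) = mu].  But then [Phi(mu)], an
    intersection over all maximal L-subgroups, lies in [M], a contradiction.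

    Two points need care.

    Zorn's lemma requires that the union of a non-empty chain of L-subgroups
    not containing [Phi(mu)] is again one.  Because [L] is upper well ordered,
    the supremum defining the union at a given point is attained by a member
    of the chain; so whatever concerns finitely many points of the union already
    happens in a single member.  This gives closure under products
    ([Lsubgroup_chain_union]), and, applied to the finitely many L-points
    generating [Phi(mu)], it shows that a union containing [Phi(mu)] has a
    member containing [Phi(mu)] ([chain_union_finitely_generated]).

    A maximal L-subgroup must also be non-constant.  Evaluating
    [eta o Phi(mu) = mu] at the identity gives [mu 1 <= eta 1 <= M 1]; since
    [mu] is largest at the identity, a constant [M] would be all of [mu]. *)

Set Implicit Arguments.
Unset Strict Implicit.
Unset Printing Implicit Defensive.

Import Order.TTheory.

Local Open Scope classical_set_scope.
Local Open Scope order_scope.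

Section CompleteLatticeFacts.
Context {d : Order.disp_t} {L : tbLatticeType d}.
Context (Lcomplete : complete_lattice L).
Implicit Types (A : set L) (a : L).

Lemma lsup_supremums A : supremums A (lsup A).
Proof.
have [supA _] := Lcomplete A; rewrite /lsup /supremum.
case: eqP => [->|_]; last exact: xgetPex supA.
by split=> [//|b _]; apply: le0x.
Qed.

Lemma linf_infimums A : infimums A (linf A).
Proof.
have [_ infA] := Lcomplete A; rewrite /linf /infimum.
case: eqP => [->|_]; last exact: xgetPex infA.
by split=> [//|b _]; apply: lex1.
Qed.

Lemma lsup_ub A a : A a -> a <= lsup A.
Proof. by have [ubA _] := lsup_supremums A; apply: ubA. Qed.

Lemma lsup_le A a : (forall b, A b -> b <= a) -> lsup A <= a.
Proof. by have [_ leA] := lsup_supremums A; apply: leA. Qed.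

Lemma linf_lb A a : A a -> linf A <= a.
Proof. by have [lbA _] := linf_infimums A; apply: lbA. Qed.

End CompleteLatticeFacts.

Section LSubgroupFacts.
Context {d : Order.disp_t} {L : tbLatticeType d} {G : groupType}.
Implicit Types (mu nu eta theta : G -> L) (C : set (G -> L)).

Lemma Lsubset_refl eta : Lsubset eta eta.
Proof. by move=> x. Qed.

Lemma Lsubset_trans theta eta mu :
  Lsubset eta theta -> Lsubset theta mu -> Lsubset eta mu.
Proof. by move=> le1 le2 x; apply: le_trans (le1 x) (le2 x). Qed.

Lemma Lsubset_anti eta theta :
  Lsubset eta theta -> Lsubset theta eta -> eta = theta.
Proof.
by move=> le1 le2; apply: funext => x; apply: le_anti; rewrite le1 le2.
Qed.

Lemma Lsubgroup_le1 mu x : Lsubgroup mu -> mu x <= mu 1%g.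
Proof.
by case=> muM muV; have := muM x (x^-1)%g; rewrite muV meetxx mulgV.
Qed.

Lemma Lprod_subset eta nu theta : complete_lattice L -> Lsubgroup theta ->
  Lsubset eta theta -> Lsubset nu theta -> Lsubset (Lprod eta nu) theta.
Proof.
move=> Lc [thM _] le_eta le_nu x; apply: lsup_le => // _ [y [z [-> ->]]].
by apply: le_trans (thM y z); apply: leI2.
Qed.

(** Each term [eta y `&` nu z] of the supremum defining the product at the
    identity is bounded by [eta y <= eta 1]. *)
Lemma Lprod1_le eta nu : complete_lattice L -> Lsubgroup eta ->
  Lprod eta nu 1%g <= eta 1%g.
Proof.
move=> Lc etaG; apply: lsup_le => // _ [y [z [_ ->]]].
by apply: le_trans (Lsubgroup_le1 y etaG); apply: leIl.
Qed.

Lemma Lpoints_union_le (s : seq (L * G)) theta :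
  (forall p, p \in s -> Lpoint_in p.1 p.2 theta) ->
  Lsubset (Lpoints_union s) theta.
Proof.
move=> s_th x; rewrite /Lpoints_union; apply/joinsP_seq => p ps _.
by rewrite /Lpoint; case: eqP => [->|_]; [apply: s_th | apply: le0x].
Qed.

Lemma Frattini_subset mu : complete_lattice L -> Lsubset (Frattini mu) mu.
Proof.
move=> Lc x; rewrite /Frattini; case: asboolP => // -[M maxM].
have [[[_ leM] _ _] _] := maxM.
by apply: le_trans (leM x); apply: linf_lb => //; exists M.
Qed.

Lemma Frattini_maximal mu M : complete_lattice L -> Lmaximal mu M ->
  Lsubset (Frattini mu) M.
Proof.
move=> Lc maxM x; rewrite /Frattini; case: asboolP => [_|[]]; last by exists M.
by apply: linf_lb => //; exists M.
Qed.

Definition Lunion C : G -> L := fun x => lsup [set theta x | theta in C].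

Definition Lchain C := total_on C (fun eta theta => Lsubset eta theta).

Lemma Lunion_ub C theta : complete_lattice L -> C theta ->
  Lsubset theta (Lunion C).
Proof. by move=> Lc Cth x; apply: lsup_ub => //; exists theta. Qed.

Lemma Lunion_le C mu : complete_lattice L ->
  (forall theta, C theta -> Lsubset theta mu) -> Lsubset (Lunion C) mu.
Proof. by move=> Lc Cmu x; apply: lsup_le => // _ [th Cth <-]; apply: Cmu. Qed.

Lemma Lunion_attained C x : upper_well_ordered L -> C !=set0 ->
  exists2 theta, C theta & theta x = Lunion C x.
Proof.
move=> Luwo [theta Cth].
have [|th' Cth' th'x] := Luwo [set th x | th in C];
  first by exists (theta x), theta.
by exists th'.
Qed.

(** Each value of the union is attained by a member, and the largest of
    finitely many members of a chain attains all the values at once. *)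
Lemma Lunion_attained_seq C (s : seq G) : complete_lattice L ->
  upper_well_ordered L -> Lchain C -> C !=set0 ->
  exists2 theta, C theta & forall x, x \in s -> theta x = Lunion C x.
Proof.
move=> Lc Luwo Cchain Cn0; elim: s => [|x s [th Cth th_s]].
  by case: Cn0 => th Cth; exists th.
have [th' Cth' th'x] := Lunion_attained x Luwo Cn0.
have [le_th|le_th] := Cchain _ _ Cth Cth'.
- exists th' => // y; rewrite inE => /predU1P[-> //|ys].
  by apply: le_anti; rewrite Lunion_ub //= -th_s // le_th.
- exists th => // y; rewrite inE => /predU1P[->|/th_s //].
  by apply: le_anti; rewrite Lunion_ub //= -th'x le_th.
Qed.

Lemma Lsubgroup_chain_union C : complete_lattice L -> upper_well_ordered L ->
  Lchain C -> C !=set0 -> (forall theta, C theta -> Lsubgroup theta) ->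
  Lsubgroup (Lunion C).
Proof.
move=> Lc Luwo Cchain Cn0 CG; split=> [x y|x].
- have [th Cth thE] := Lunion_attained_seq [:: x; y] Lc Luwo Cchain Cn0.
  rewrite -(thE x) ?inE ?eqxx // -(thE y) ?inE ?eqxx ?orbT //; have [thM _] := CG _ Cth.
  by apply: le_trans (thM x y) _; apply: Lunion_ub.
- congr lsup; apply: eq_imagel => th Cth.
  by have [_ ->] := CG _ Cth.
Qed.

(** A member attaining the union at the base points of the generating
    L-points contains these L-points, hence all they generate. *)
Lemma chain_union_finitely_generated C nu : complete_lattice L ->
  upper_well_ordered L -> Lchain C -> C !=set0 ->
  (forall theta, C theta -> Lsubgroup theta) ->
  Lfinitely_generated nu -> Lsubset nu (Lunion C) ->
  exists2 theta, C theta & Lsubset nu theta.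
Proof.
move=> Lc Luwo Cchain Cn0 CG [s [s_nu [_ _ nu_min]]] nuC.
have [th Cth thE] :=
  Lunion_attained_seq [seq p.2 | p <- s] Lc Luwo Cchain Cn0.
exists th => //; apply: nu_min; first exact: CG.
apply: Lpoints_union_le => p ps; rewrite /Lpoint_in thE ?map_f //.
exact: le_trans (s_nu p ps) (nuC _).
Qed.

(** The union of a non-empty chain bounds it, and any member of [F] bounds the
    empty chain. *)
Lemma Lsubset_Zorn (F : set (G -> L)) : complete_lattice L -> F !=set0 ->
  (forall C, C `<=` F -> Lchain C -> C !=set0 -> F (Lunion C)) ->
  exists2 M, F M & forall theta, F theta -> Lsubset M theta -> theta = M.
Proof.
move=> Lc [eta Feta] Funion.
pose R (s t : {theta | F theta}) := `[< Lsubset (sval s) (sval t) >].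
have [||||[M FM] Mmax] := @Zorn _ R.
- by move=> t; apply/asboolP; apply: Lsubset_refl.
- move=> r s t /asboolP rs /asboolP st; apply/asboolP.
  exact: Lsubset_trans rs st.
- move=> [s Fs] [t Ft] /asboolP/= st /asboolP/= ts.
  by apply: eq_exist; apply: Lsubset_anti.
- move=> A Achain; have [An0|/set0P/negP] := pselect (A !=set0); last first.
    by rewrite negbK => /eqP ->; exists (exist _ eta Feta).
  have AF : [set sval s | s in A] `<=` F by move=> _ [[s Fs] _ <-].
  have FU : F (Lunion [set sval s | s in A]).
    apply: Funion => //; last by case: An0 => s As; exists (sval s), s.
    move=> _ _ [s As <-] [t At <-].
    by have [/asboolP|/asboolP] := Achain _ _ As At; [left|right].
  exists (exist _ _ FU) => s As; apply/asboolP => /=.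
  by apply: Lunion_ub => //; exists s.
- exists M => // theta Fth leM.
  have := Mmax (exist _ theta Fth); rewrite /R /=.
  by move=> /(_ (asboolT leM)) [].
Qed.

(** By [chain_union_finitely_generated], not containing a finitely generated
    [nu] is preserved by unions of chains; this is the only condition in the
    Zorn argument for which finite generation matters. *)
Lemma maximal_avoiding mu nu eta : complete_lattice L ->
  upper_well_ordered L -> Lfinitely_generated nu ->
  Lsubgroup_of mu eta -> ~ Lsubset nu eta ->
  exists M, [/\ Lsubgroup_of mu M, Lsubset eta M, ~ Lsubset nu M &
    forall theta, Lsubgroup_of mu theta -> Lsubset M theta ->
      ~ Lsubset nu theta -> theta = M].
Proof.
move=> Lc Luwo nu_fg eta_mu nu_eta.
pose F : set (G -> L) := [set theta |
  [/\ Lsubgroup_of mu theta, Lsubset eta theta & ~ Lsubset nu theta]].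
have [||M [M_mu leM nuM] Mmax] := @Lsubset_Zorn F Lc.
- by exists eta; split=> //; apply: Lsubset_refl.
- move=> C CF Cchain Cn0.
  have CG th : C th -> Lsubgroup th by move=> /CF[[]].
  split; first split.
  + exact: Lsubgroup_chain_union.
  + by apply: Lunion_le => // th /CF[[]].
  + case: Cn0 => th Cth; have [_ le_th _] := CF _ Cth.
    by apply: Lsubset_trans le_th _; apply: Lunion_ub.
  + move=> /(chain_union_finitely_generated Lc Luwo Cchain Cn0 CG nu_fg).
    by case=> th /CF[].
- exists M; split=> // theta th_mu le_th nu_th; apply: Mmax => //.
  by split=> //; apply: Lsubset_trans le_th.
Qed.

End LSubgroupFacts.

Theorem theorem5p6 (d : Order.disp_t) (L : tbLatticeType d) (G : groupType)
    (mu : G -> L) :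
  completely_distributive L -> upper_well_ordered L ->
  Lsubgroup mu -> Lfinitely_generated (Frattini mu) ->
  forall eta : G -> L,
    Lsubgroup_of mu eta -> Lprod eta (Frattini mu) = mu -> eta = mu.
Proof.
move=> [Lc _] Luwo muG Phi_fg eta eta_mu prod_mu.
have [etaG le_eta_mu] := eta_mu.
have containsP theta : Lsubgroup_of mu theta -> Lsubset eta theta ->
    Lsubset (Frattini mu) theta -> theta = mu.
  move=> [thG th_mu] le_eta le_Phi; apply: Lsubset_anti => //.
  by rewrite -prod_mu; apply: Lprod_subset.
apply: contrapT => eta_neq.
have [|M [M_mu leM PhiM Mmax]] := maximal_avoiding Lc Luwo Phi_fg eta_mu.
  by move=> le_Phi; apply/eta_neq/containsP => //; apply: Lsubset_refl.
have M_neq : M <> mu by move=> ME; apply: PhiM; rewrite ME; apply: Frattini_subset.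
apply: PhiM; apply: Frattini_maximal => //; split; first split=> //.
- case=> c Mc; apply: M_neq; have [_ le_M_mu] := M_mu.
  apply: Lsubset_anti => // x; rewrite Mc -(Mc 1%g).
  apply: le_trans (Lsubgroup_le1 x muG) _; apply: le_trans (leM 1%g).
  by rewrite -{1}prod_mu; apply: Lprod1_le.
- move=> theta th_mu le_th.
  have [le_Phi|nle_Phi] := pselect (Lsubset (Frattini mu) theta).
    by right; apply: containsP => //; apply: Lsubset_trans le_th.
  by left; apply: Mmax.
Qed.
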